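(* Let $\Gamma\rightrightarrows E$ be a groupoid, $X$ a set, and let $\Phi$ be a relational action of $\Gamma$ on $X$. Then: (1) for every $x\in X$ there exists a unique $e\in E$ such that $(x;e,x)\in\Phi$, i.e. $\Phi$ defines a mapping $\rho:X\to E$; (2) $D(\Phi)=\{(\gamma,x)\in\Gamma\times X: e_R(\gamma)=\rho(x)\}$; (3) $(y;\gamma,x)\in\Phi\Rightarrow\rho(y)=e_L(\gamma)$; (4) $(y;\gamma,x)\in\Phi\iff(x;s(\gamma),y)\in\Phi$; (5) $\Phi$ is a mapping $D(\Phi)\to X$, and this mapping is a standard action of $\Gamma$ on $X$ (with respect to $\rho$). (6) Moreover, if $\Gamma$ acts on $X$ by a standard action with respect to a mapping $\rho:X\to E$, then the relation $\{(\gamma x;\gamma,x): e_R(\gamma)=\rho(x)\}$ is a relational action of $\Gamma$ on $X$.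
   Context: A relation $r$ from a set $X$ to a set $Y$ is given by its graph, a subset of $Y\times X$; we write $(y,x)\in r$. Its domain is $D(r)=\{x:\exists y,\ (y,x)\in r\}$. Relations are composed by $(z,x)\in tr\iff\exists y:\ (z,y)\in t,\ (y,x)\in r$, and $r\times r_1=\{(y,y_1;x,x_1):(y,x)\in r,\ (y_1,x_1)\in r_1\}$. A groupoid $\Gamma\rightrightarrows E$ is a small category with all morphisms invertible; $\Gamma$ is the set of morphisms and $E\subset\Gamma$ the set of identities. $s(\gamma)$ is the inverse of $\gamma$, $e_R(\gamma)=s(\gamma)\gamma$ is its source, $e_L(\gamma)=\gamma s(\gamma)$ its target; $\gamma_1\gamma_2$ is defined iff $e_R(\gamma_1)=e_L(\gamma_2)$. The multiplication is the relation $m$ from $\Gamma\times\Gamma$ to $\Gamma$ with $(\gamma;\gamma_1,\gamma_2)\in m$ iff $\gamma_1\gamma_2$ is defined and equals $\gamma$. The unit is the relation $e$ from a one point set $\{1\}$ to $\Gamma$ with image $E$. Relational action: a relation $\Phi$ from $\Gamma\times X$ to $X$ satisfying $\Phi(m\times id)=\Phi(id\times\Phi)$ and $\Phi(e\times id)=id$ (with $\{1\}\times X$ identified with $X$, so the last condition says that $\{(y,x):\exists e\in E,\ (y;e,x)\in\Phi\}$ is the diagonal of $X$). Standard action: given a mapping $\rho:X\to E$, a mapping $\{(\gamma,x)\in\Gamma\times X:e_R(\gamma)=\rho(x)\}\ni(\gamma,x)\mapsto\gamma x\in X$ satisfying $\rho(x)x=x$ and $\gamma_1(\gamma_2x)=(\gamma_1\gamma_2)x$,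 in the sense that if one side is defined then so is the other and they are equal. *)

(* Defs.v *)
From mathcomp Require Import all_boot.
From mathcomp Require Import boolp classical_sets.

Set Implicit Arguments.
Unset Strict Implicit.
Unset Printing Implicit Defensive.

Local Open Scope classical_set_scope.

(* A relation from X to Y; [r (y, x)] reads (y, x) \in r. *)
Definition relation (X Y : Type) := set (Y * X).

Definition rdom (X Y : Type) (r : relation X Y) : set X :=
  [set x | exists y, r (y, x)].

Definition rcomp (X Y Z : Type) (t : relation Y Z) (r : relation X Y) :
    relation X Z :=
  [set p | exists y, t (p.1, y) /\ r (y, p.2)].

Definition rprod (X Y X1 Y1 : Type) (r : relation X Y) (r1 : relation X1 Y1) :
    relation (X * X1) (Y * Y1) :=
  [set p | r (p.1.1, p.2.1) /\ r1 (p.1.2, p.2.2)].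

Definition rid (X : Type) : relation X X := [set p | p.1 = p.2].

(* Small categories are presented by their arrows only, an object being
   identified with its identity arrow: [e_R a] and [e_L a] are the identities at
   the source and at the target of [a], and [cmul a b] is "a after b". *)
Record small_category := SmallCategory {
  arrow :> Type;
  e_R : arrow -> arrow;
  e_L : arrow -> arrow;
  cmul : forall a b : arrow, e_R a = e_L b -> arrow;
  e_R_e_R : forall a, e_R (e_R a) = e_R a;
  e_L_e_R : forall a, e_L (e_R a) = e_R a;
  e_R_e_L : forall a, e_R (e_L a) = e_L a;
  e_L_e_L : forall a, e_L (e_L a) = e_L a;
  e_R_cmul : forall a b (h : e_R a = e_L b), e_R (cmul h) = e_R b;
  e_L_cmul : forall a b (h : e_R a = e_L b), e_L (cmul h) = e_L a;
  cmulA : forall a b c (hab : e_R a = e_L b) (hbc : e_R b = e_L c)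
    (hab_c : e_R (cmul hab) = e_L c) (ha_bc : e_R a = e_L (cmul hbc)),
    cmul hab_c = cmul ha_bc;
  cmul_e_L : forall a (h : e_R (e_L a) = e_L a), cmul h = a;
  cmul_e_R : forall a (h : e_R a = e_L (e_R a)), cmul h = a
}.

Arguments e_R {s} a.
Arguments e_L {s} a.
Arguments cmul {s} a b h.

Definition is_inverse (C : small_category) (b a : C) : Prop :=
  (exists h : e_R b = e_L a, cmul b a h = e_R a) /\
  (exists h : e_R a = e_L b, cmul a b h = e_L a).

Record groupoid := Groupoid {
  category :> small_category;
  ginv : category -> category;
  invP : forall a, is_inverse (ginv a) a
}.

Arguments ginv {g} a.

Definition identities (G : groupoid) : set G := [set u | e_R u = u].

Definition gmult (G : groupoid) : relation (G * G) G :=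
  [set p | exists h : e_R p.2.1 = e_L p.2.2, cmul p.2.1 p.2.2 h = p.1].

Definition gunit (G : groupoid) : relation unit G :=
  [set p | identities p.1].

(* (G * G) * X is identified with G * (G * X) in the first condition, and
   unit * X with X in the second. *)
Definition relational_action (G : groupoid) (X : Type)
    (Phi : relation (G * X) X) : Prop :=
  (forall (y : X) (a b : G) (x : X),
     rcomp Phi (rprod (@gmult G) (@rid X)) (y, ((a, b), x)) <->
     rcomp Phi (rprod (@rid G) Phi) (y, (a, (b, x)))) /\
  (forall y x : X,
     rcomp Phi (rprod (@gunit G) (@rid X)) (y, (tt, x)) <-> @rid X (y, x)).

(* A mapping {(a, x) | e_R a = rho x} -> X. *)
Definition action_map (G : groupoid) (X : Type) (rho : X -> G) :=
  forall (a : G) (x : X), e_R a = rho x -> X.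

(* The last clause is equality of the partial expressions a (b x) and (a b) x:
   each side asserts that the expression is defined and has value y. *)
Definition standard_action (G : groupoid) (X : Type) (rho : X -> G)
    (act : action_map rho) : Prop :=
  [/\ forall x, identities (rho x),
      forall x, exists h : e_R (rho x) = rho x, act (rho x) x h = x &
      forall (a b : G) (x y : X),
        (exists (hb : e_R b = rho x) (ha : e_R a = rho (act b x hb)),
           act a (act b x hb) ha = y) <->
        (exists (hab : e_R a = e_L b) (h : e_R (cmul a b hab) = rho x),
           act (cmul a b hab) x h = y)].

Definition action_graph (G : groupoid) (X : Type) (rho : X -> G)
    (act : action_map rho) : relation (G * X) X :=
  [set p | exists h : e_R p.2.1 = rho p.2.2, act p.2.1 p.2.2 h = p.1].

(* Main.v *)
Require Import Defs.
From mathcomp Require Import all_boot.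
From mathcomp Require Import boolp classical_sets.

(** Unfolding the compositions of relations, a relational action consists of
    two laws ([relational_actionP]).
    - Associativity: there is a [z] with [(y; a, z)] and [(z; b, x)] in [Phi]
      if and only if [a b] is defined and [(y; a b, x)] is in [Phi].
    - Unit: [(y; u, x)] is in [Phi] for some identity [u] if and only if
      [y = x].

    The associativity law contains the whole structure, because it forces
    composability: two consecutive steps of [Phi] can be taken only along
    composable arrows ([step_composable]).  The unit law provides at each point
    [x] some identity [u] with [(x; u, x)] in [Phi]; two such identities are
    consecutive steps at [x], hence composable, hence equal.  This is the anchor
    [rho x].  Inserting the unit step at either end of a step [(y; a, x)] gives
    [e_R a = rho x] and [rho y = e_L a].

    Conversely, if [e_R a = rho x], the unit step at [x] runs along
    [e_R a = s(a) a], so by associativity it factors through a step along [a]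
    that starts at [x]: the domain of [Phi] is as large as it can be.  In this
    factorization [(x; s(a), z)], [(z; a, x)], any step [(y; a, x)] composes with
    [(x; s(a), z)] to a step from [z] to [y] along the identity [a s(a)], so
    [y = z].  Thus [Phi] is single valued and [(y; a, x)] may be reversed to
    [(x; s(a), y)] ([step_inverse], [step_functional]).

    What remains of the passage between the two notions of action is a
    dictionary: a mapping satisfies the axioms of a standard action exactly when
    its graph satisfies the two laws ([standard_actionP]).  It shows
    that the mapping obtained from [Phi] is a standard action, and that the
    graph of any standard action is a relational action. *)

Set Implicit Arguments.
Unset Strict Implicit.
Unset Printing Implicit Defensive.

Local Open Scope classical_set_scope.

(** * Identities and inverses in a groupoid *)

Lemma identities_e_L (G : groupoid) (a : G) : identities (e_L a).
Proof. exact: e_R_e_L. Qed.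

Lemma e_L_identity (G : groupoid) (u : G) : identities u -> e_L u = u.
Proof. by move=> hu; rewrite -[in LHS]hu e_L_e_R. Qed.

Lemma is_inverse_sym (C : small_category) (a b : C) :
  is_inverse b a -> is_inverse a b.
Proof.
move=> [[hba ba] [hab ab]]; split.
- by exists hab; rewrite ab hba.
- by exists hba; rewrite ba hab.
Qed.

(** * The two laws of a relational action *)

Lemma relational_actionP (G : groupoid) (X : Type) (Phi : relation (G * X) X) :
  relational_action Phi <->
  (forall (y : X) (a b : G) (x : X),
     (exists h : e_R a = e_L b, Phi (y, (cmul a b h, x))) <->
     (exists z, Phi (y, (a, z)) /\ Phi (z, (b, x)))) /\
  (forall y x : X, (exists u, identities u /\ Phi (y, (u, x))) <-> y = x).
Proof.
have multE y a b x : rcomp Phi (rprod (@gmult G) (@rid X)) (y, ((a, b), x)) <->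
    exists h : e_R a = e_L b, Phi (y, (cmul a b h, x)).
  split=> [[[c w] [Pc [[/= h cE] /= wE]]] | [h Ph]].
    by rewrite /rid /= in wE; subst c w; exists h.
  by exists (cmul a b h, x); split=> //; split=> //; exists h.
have stepE y a b x : rcomp Phi (rprod (@rid G) Phi) (y, (a, (b, x))) <->
    exists z, Phi (y, (a, z)) /\ Phi (z, (b, x)).
  split=> [[[c z] [Pc [/= cE Pz]]] | [z [Pa Pb]]].
    by rewrite /rid /= in cE; subst c; exists z.
  by exists (a, z).
have unitE y x : rcomp Phi (rprod (@gunit G) (@rid X)) (y, (tt, x)) <->
    exists u, identities u /\ Phi (y, (u, x)).
  split=> [[[u w] [Pu [/= hu wE]]] | [u [hu Pu]]].
    by rewrite /rid /= in wE; subst w; exists u.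
  by exists (u, x).
split=> -[assoc unit_law]; split.
- by move=> y a b x; rewrite -multE -stepE.
- by move=> y x; rewrite -unitE; exact: unit_law.
- by move=> y a b x; rewrite multE stepE.
- by move=> y x; rewrite unitE; exact: unit_law.
Qed.

(** * Steps of a relational action *)

Section RelationalAction.
Context {G : groupoid} {X : Type} {Phi : relation (G * X) X}.
Hypothesis PhiP : relational_action Phi.

Lemma step_cmul (y z x : X) (a b : G) (h : e_R a = e_L b) :
  Phi (y, (a, z)) -> Phi (z, (b, x)) -> Phi (y, (cmul a b h, x)).
Proof.
move=> Pa Pb; have [assoc _] := (relational_actionP _).1 PhiP.
have [h' Ph] : exists h : e_R a = e_L b, Phi (y, (cmul a b h, x)).
  by apply/assoc; exists z.
by rewrite (Prop_irrelevance h h').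
Qed.

Lemma step_factor (y x : X) (a b : G) (h : e_R a = e_L b) :
  Phi (y, (cmul a b h, x)) -> exists z, Phi (y, (a, z)) /\ Phi (z, (b, x)).
Proof.
move=> Pab; have [assoc _] := (relational_actionP _).1 PhiP.
by apply/assoc; exists h.
Qed.

(** A composite of steps is related by [Phi (id x Phi)], hence by
    [Phi (m x id)], whose domain only involves composable pairs. *)
Lemma step_composable (y z x : X) (a b : G) :
  Phi (y, (a, z)) -> Phi (z, (b, x)) -> e_R a = e_L b.
Proof.
move=> Pa Pb; have [assoc _] := (relational_actionP _).1 PhiP.
have [h _] : exists h : e_R a = e_L b, Phi (y, (cmul a b h, x)).
  by apply/assoc; exists z.
exact: h.
Qed.

Lemma step_identity (y x : X) (u : G) :
  identities u -> Phi (y, (u, x)) -> y = x.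
Proof.
move=> hu Pu; have [_ unit_law] := (relational_actionP _).1 PhiP.
by apply/unit_law; exists u.
Qed.

(** Existence is the unit law; two unit steps at [x] are consecutive, hence
    along composable identities, and composable identities are equal. *)
Lemma anchor_exists_unique (x : X) :
  exists! u : G, identities u /\ Phi (x, (u, x)).
Proof.
have [_ unit_law] := (relational_actionP _).1 PhiP.
have [u [hu Pu]] := (unit_law x x).2 erefl.
exists u; split=> // v [hv Pv].
by rewrite -hu (step_composable Pu Pv) e_L_identity.
Qed.

(** The unit step at [x] runs along [e_R a = b a]; factor it as
    [(x; b, z)] and [(z; a, x)].  Following [(x; b, z)] by the given step from
    [x] to [y] yields a step from [z] to [y] along the identity [a b], so
    [z = y]. *)
Lemma step_inverse (a b : G) (y x : X) :
  is_inverse b a -> Phi (y, (a, x)) -> Phi (x, (b, y)).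
Proof.
move=> [[hba ba] [hab ab]] Pa.
have [u [[hu Pu] _]] := anchor_exists_unique x.
have uE : u = e_R a by rewrite (step_composable Pa Pu) e_L_identity.
rewrite uE -ba in Pu; have [z [Pb _]] := step_factor Pu.
have := step_cmul hab Pa Pb.
by rewrite ab => /(step_identity (identities_e_L _)) ->.
Qed.

(** Undo the second step, then redo the first: this moves [y2] to [y1] along the
    identity [a s(a)]. *)
Lemma step_functional (a : G) (y1 y2 x : X) :
  Phi (y1, (a, x)) -> Phi (y2, (a, x)) -> y1 = y2.
Proof.
move=> P1 /(step_inverse (invP a)) P2.
have [_ [h ahE]] := invP a.
have := step_cmul h P1 P2; rewrite ahE.
exact: step_identity (identities_e_L _).
Qed.

Section Anchor.
Variable rho : X -> G.
Hypothesis rhoP : forall x, identities (rho x) /\ Phi (x, (rho x, x)).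

Lemma step_source (y x : X) (a : G) : Phi (y, (a, x)) -> e_R a = rho x.
Proof.
have [hx Px] := rhoP x.
by move=> /step_composable /(_ Px) ->; rewrite e_L_identity.
Qed.

Lemma step_target (y x : X) (a : G) : Phi (y, (a, x)) -> rho y = e_L a.
Proof.
have [hy Py] := rhoP y.
by move=> /(step_composable Py) <-; rewrite hy.
Qed.

(** The unit step at [x] runs along [s(a) a]; of its two factors, the one
    along [a] starts at [x]. *)
Lemma step_exists (a : G) (x : X) : e_R a = rho x -> exists y, Phi (y, (a, x)).
Proof.
move=> ax; have [[h baE] _] := invP a; have [_ Px] := rhoP x.
rewrite -ax -baE in Px.
by have [z [_ Pz]] := step_factor Px; exists z.
Qed.

Lemma rdom_relational_action : rdom Phi = [set p : G * X | e_R p.1 = rho p.2].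
Proof.
apply/seteqP; split=> [[a x] [y] | [a x]] /=; first exact: step_source.
exact: step_exists.
Qed.

Lemma relational_action_graph :
  exists act : action_map rho, Phi = action_graph act.
Proof.
exists (fun a x ax => sval (cid (step_exists ax))).
apply/seteqP; split=> [[y [a x]] Pa | [y [a x]] [/= ax <-]].
- exists (step_source Pa) => /=.
  by case: cid => z /= Pz; exact: step_functional Pz Pa.
- by case: cid.
Qed.

End Anchor.
End RelationalAction.

(** * Standard actions and their graphs *)

(** The partial expression [a (b x)] is a composite of steps of the graph. *)
Lemma nested_actionP (G : groupoid) (X : Type) (rho : X -> G)
    (act : action_map rho) (a b : G) (x y : X) :
  (exists (hb : e_R b = rho x) (ha : e_R a = rho (act b x hb)),
     act a (act b x hb) ha = y) <->
  (exists z, action_graph act (y, (a, z)) /\ action_graph act (z, (b, x))).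
Proof.
split=> [[hb [ha yE]] | [z [Pa [/= hb zE]]]].
- by exists (act b x hb); split; [exists ha | exists hb].
- by subst z; case: Pa => /= ha yE; exists hb, ha.
Qed.

(** Associativity of the mapping is associativity of its graph, read through
    [nested_actionP].  For the units, the only identity that acts on [x] is
    [rho x], so the unit law says that [rho x] fixes [x]. *)
Lemma standard_actionP (G : groupoid) (X : Type) (rho : X -> G)
    (act : action_map rho) :
  (forall x, identities (rho x)) ->
  (standard_action act <-> relational_action (action_graph act)).
Proof.
move=> hrho; rewrite relational_actionP; split.
- move=> [_ unit_act assoc]; split=> [y a b x | y x].
    by rewrite -nested_actionP; split=> /assoc.
  have [hx xE] := unit_act x; split=> [[u [hu [/= ux yE]]] | ->].
    (* The proof [ux] depends on [u], so [u] has to be replaced throughout. *)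
    have uE : u = rho x by rewrite -ux hu.
    by subst u; rewrite -yE -[RHS]xE (Prop_irrelevance ux hx).
  by exists (rho x); split=> //; exists hx.
- move=> [assoc unit_law]; split=> // [x | a b x y].
    exists (hrho x); apply/unit_law.
    by exists (rho x); split=> //; exists (hrho x).
  by rewrite nested_actionP; split=> /assoc.
Qed.

Theorem proposition4p4 (G : groupoid) (X : Type) :
  (forall Phi : relation (G * X) X, relational_action Phi ->
     (forall x : X, exists! e : G, identities e /\ Phi (x, (e, x))) /\
     (exists rho : X -> G,
        [/\ forall x, identities (rho x) /\ Phi (x, (rho x, x)),
            rdom Phi = [set p : G * X | e_R p.1 = rho p.2],
            forall (y : X) (a : G) (x : X), Phi (y, (a, x)) -> rho y = e_L a,
            forall (y : X) (a : G) (x : X),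
              Phi (y, (a, x)) <-> Phi (x, (ginv a, y)) &
            (forall p : G * X, rdom Phi p -> exists! y : X, Phi (y, p)) /\
            (exists act : action_map rho,
               Phi = action_graph act /\ standard_action act)])) /\
  (forall (rho : X -> G) (act : action_map rho),
     standard_action act -> relational_action (action_graph act)).
Proof.
split=> [Phi PhiP | rho act act_std]; last first.
  by have [hrho _ _] := act_std; exact/standard_actionP.
split; first exact: anchor_exists_unique PhiP.
have /choice[rho rhoP] :
    forall x, exists u : G, identities u /\ Phi (x, (u, x)).
  by move=> x; have [u [uP _]] := anchor_exists_unique PhiP x; exists u.
exists rho; split=> //.
- exact: (rdom_relational_action PhiP rhoP).
- by move=> y a x; exact: (step_target PhiP rhoP).
- move=> y a x; split; apply: (step_inverse PhiP); first exact: invP.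
  exact/is_inverse_sym/invP.
split=> [[a x] [y Py] | ].
  by exists y; split=> // z Pz; exact: (step_functional PhiP Py Pz).
have [act PhiE] := relational_action_graph PhiP rhoP.
exists act; split=> //; apply/standard_actionP; first by move=> x; case: (rhoP x).
by rewrite -PhiE.
Qed.
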